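(* Let $(X,d)$ be a complete metric space and $(Y,\varrho)$ be a linear metric space with a translation-invariant metric. Let $r,\varepsilon,\kappa,\ell$ be positive constants such that $\kappa\ell<1$, let $U\subset X$ and $V\subset Y$ be non-empty open sets, let $F:X\rightrightarrows Y$ be a set-valued mapping with a closed graph, and let $g:X\to Y$ be a continuous single-valued mapping such that the set $$W_\varepsilon:=\big\{(x,y)\in X\times Y:\ x\in U\text{ and }B_Y\big(y-g(x),\varepsilon\ell\operatorname{dist}(x,X\setminus U)\big)\subset V\big\}$$ is non-empty. If $F$ is Milyutin regular on $U\times V$ with the constants $r$ and $\kappa$ and $g$ is Lipschitz continuous on $U$ with the constant $\ell$, then for each $\hat\kappa>\kappa/(1-\kappa\ell)$ the mapping $F+g$ is Milyutin regular on $W_\varepsilon$ with the constants $\delta:=\min\{\kappa r,\varepsilon,1\}/\hat\kappa$ and $\hat\kappa$.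
   Context: Vector spaces are real. For a set $W\subset X\times Y$, $W_X:=\{x\in X:\ (x,y)\in W\text{ for some }y\in Y\}$. $B_Y(y,r)$ denotes the open ball; $B_Y(y,\infty)=Y$. For $F:X\rightrightarrows Y$: $F^{-1}(y)=\{x: y\in F(x)\}$, $(F+g)(x)=F(x)+g(x)$. Convention: $\inf\emptyset=\infty$, so the distance of a point to the empty set is $\infty$. For non-empty $W\subset X\times Y$ and constants $\delta>0$, $\kappa>0$, a mapping $F:X\rightrightarrows Y$ is Milyutin regular on $W$ with the constants $\delta$ and $\kappa$ (in this order) if $\operatorname{dist}(x,F^{-1}(y))\le\kappa\operatorname{dist}(y,F(x))$ for each $(x,y)\in W$ with $\operatorname{dist}(y,F(x))<\delta\operatorname{dist}(x,X\setminus W_X)$. *)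

(* Defs.v *)
From HB Require Import structures.
From mathcomp Require Import all_boot all_order all_algebra.
From mathcomp Require Import all_classical all_reals all_analysis.
Import Order.TTheory GRing.Theory Num.Theory.
Import numFieldNormedType.Exports.

Set Implicit Arguments.
Unset Strict Implicit.
Unset Printing Implicit Defensive.

Local Open Scope classical_set_scope.
Local Open Scope ring_scope.

(* [Complete] includes a base point, so a [completeMetricType] is non-empty. *)
#[short(type="completeMetricType")]
HB.structure Definition CompleteMetric (R : numDomainType) :=
  {T of Complete T & Metric R T}.

(* The library's hierarchy has no join of [metricType] and [lmodType] other
   than through a norm, and its [tvsType] is locally convex. A linear metric
   space is therefore a [topologicalLmodType] (continuous addition and
   scaling) together with a metric [rho] inducing its topology. *)
Record linear_metric (R : realType) (Y : topologicalLmodType R)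
    (rho : Y -> Y -> R) : Prop := {
  rho_ge0 : forall x y, 0 <= rho x y ;
  rho_eq0 : forall x y, rho x y = 0 <-> x = y ;
  rho_sym : forall x y, rho x y = rho y x ;
  rho_triangle : forall x y z, rho x z <= rho x y + rho y z ;
  nbhs_rho : forall y : Y,
    nbhs y = filter_from [set e : R | 0 < e] (fun e => [set z | rho y z < e])
}.

Definition translation_invariant (R : realType) (Y : topologicalLmodType R)
    (rho : Y -> Y -> R) : Prop :=
  forall x y z, rho (x + z) (y + z) = rho x y.

Section distance.
Context (R : realType).

(* Equal to +oo when A is empty. *)
Definition dist_to (T : Type) (d : T -> T -> R) (A : set T) (x : T) : \bar R :=
  ereal_inf [set (d x a)%:E | a in A].

Lemma edist_infE (T : metricType R) (A : set T) (x : T) :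
  edist_inf A x = dist_to mdist A x.
Proof.
rewrite /edist_inf /dist_to; apply: congr1; apply: eq_imagel => y _.
rewrite /edist /=; apply/eqP; rewrite eq_le; apply/andP; split.
- apply/lee_addgt0Pr => e e0; rewrite -EFinD; apply: ereal_inf_lbound.
  exists (mdist x y + e) => //=; split.
    by rewrite (lt_le_trans e0)// lerDr mdist_ge0.
  by rewrite ballEmdist /= ltrDl.
- apply: le_ereal_inf_tmp => _ /= [r [_ +] <-].
  by rewrite ballEmdist lee_fin => /ltW.
Qed.

(* Open ball with a radius in the extended reals: all of T for +oo. *)
Definition eball (T : Type) (d : T -> T -> R) (x : T) (r : \bar R) : set T :=
  [set y | ((d x y)%:E < r)%E].

Definition lipschitz_cst_on (X Y : Type) (dX : X -> X -> R) (dY : Y -> Y -> R)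
    (U : set X) (l : R) (g : X -> Y) : Prop :=
  forall x x', U x -> U x' -> dY (g x) (g x') <= l * dX x x'.

End distance.

(* Set-valued mappings are functions [X -> set Y]. *)
Definition graph_of (X Y : Type) (F : X -> set Y) : set (X * Y) :=
  [set p | F p.1 p.2].

Definition inv_sv (X Y : Type) (F : X -> set Y) (y : Y) : set X :=
  [set x | F x y].

Definition add_sv (X : Type) (Y : zmodType) (F : X -> set Y) (g : X -> Y) :
    X -> set Y :=
  fun x => [set z + g x | z in F x].

(* [fst @` W] is the projection of W to X. *)
Definition milyutin_regular (R : realType) (X Y : Type)
    (dX : X -> X -> R) (dY : Y -> Y -> R)
    (F : X -> set Y) (W : set (X * Y)) (delta kappa : R) : Prop :=
  forall x y, W (x, y) ->
    (dist_to dY (F x) y < delta%:E * dist_to dX (~` (fst @` W)) x)%E ->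
    (dist_to dX (inv_sv F y) x <= kappa%:E * dist_to dY (F x) y)%E.

Definition W_eps (R : realType) (X : Type) (Y : zmodType)
    (dX : X -> X -> R) (dY : Y -> Y -> R)
    (U : set X) (V : set Y) (g : X -> Y) (eps l : R) : set (X * Y) :=
  [set p | U p.1 /\
    eball dY (p.2 - g p.1) ((eps * l)%:E * dist_to dX (~` U) p.1)%E `<=` V].

(* Main.v *)
(** Lyusternik-Graves iteration. A preimage of [y] under [F + g] is a fixed
    point of "given [x], choose [x'] near [x] with [y - g x] in [F x']".
    Regularity of [F] gives [d(x, x') <= k s], where [s] bounds the residual
    [dist(y - g x, F x)] and [k > kappa]; since [y - g x] lies in [F x'], the
    next residual is at most [rho(g x, g x') <= k l s], so residuals decay
    geometrically, and with [k / (1 - k l) = hkappa] the iterates stay within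
    [hkappa t] of the starting point, [t] being the initial residual bound.
    The three terms of the minimum in [delta] keep, respectively, the
    regularity condition of [F], the membership of [y - g x] in [V], and that
    of [x] in [U] valid along the iteration. *)

Require Import Defs.
From HB Require Import structures.
From mathcomp Require Import all_boot all_order all_algebra.
From mathcomp Require Import all_classical all_reals all_analysis.
From mathcomp Require Import ring lra.
Import Order.TTheory GRing.Theory Num.Theory.
Import numFieldNormedType.Exports.

Local Open Scope classical_set_scope.
Local Open Scope ring_scope.

Lemma lte_between_fin {R : realType} {a b : \bar R} : (0 <= a)%E -> (a < b)%E ->
  exists t : R, (a < t%:E)%E /\ (t%:E < b)%E.
Proof.
case: a => [a| |]//; case: b => [b| |]// _ ab.
  rewrite lte_fin in ab; exists ((a + b) / 2).
  by rewrite !lte_fin; split; lra.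
by exists (a + 1); rewrite ltry lte_fin ltrDl.
Qed.

Section dist_to_theory.
Context {R : realType} {T : Type} {d : T -> T -> R}.
Implicit Types (A B : set T) (x : T).

Lemma dist_to_le {A x a} : A a -> (dist_to d A x <= (d x a)%:E)%E.
Proof. by move=> Aa; apply: ereal_inf_lbound; exists a. Qed.

Lemma dist_to_lt {A x} {c : R} :
  (dist_to d A x < c%:E)%E -> exists2 a, A a & d x a < c.
Proof. by move=> /ereal_inf_lt[_ [a Aa <-]]; rewrite lte_fin; exists a. Qed.

Lemma le_dist_to {A x} {c : \bar R} :
  (forall a, A a -> (c <= (d x a)%:E)%E) -> (c <= dist_to d A x)%E.
Proof. by move=> cA; apply: le_ereal_inf_tmp => _ [a Aa <-]; exact: cA. Qed.

Lemma dist_to_subset {A B} x : A `<=` B -> (dist_to d B x <= dist_to d A x)%E.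
Proof. by move=> AB; apply: le_dist_to => a /AB; exact: dist_to_le. Qed.

End dist_to_theory.

(** * Sequences of finite length in a complete space *)

Section telescoping_sequence.
Context {R : realType} {X : completeMetricType R}.

Lemma mdist_telescope {x : nat -> X} {u : nat -> R} :
  (forall n, mdist (x n) (x n.+1) <= u n - u n.+1) ->
  forall n k, mdist (x n) (x (n + k)%N) <= u n - u (n + k)%N.
Proof.
move=> xu n; elim=> [|k IHk]; first by rewrite addn0 mdistxx subrr.
rewrite addnS (le_trans (metric_triangle _ (x (n + k)%N) _))//.
by have := xu (n + k)%N; lra.
Qed.

(** [u n] acts as a budget for all movement after step [n]: later terms stay within [u n] of [x n],
    which makes the sequence Cauchy without summing a series. *)
Lemma telescoping_cvg {x : nat -> X} {u : nat -> R} :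
  (forall n, 0 <= u n) -> u @ \oo --> 0 ->
  (forall n, mdist (x n) (x n.+1) <= u n - u n.+1) ->
  exists2 a, x @ \oo --> a & mdist (x 0%N) a <= u 0%N.
Proof.
move=> u_ge0 u_cvg xu; have xx := mdist_telescope xu.
have /cvg_ex[a xa] : cvg (x @ \oo).
  apply: cauchy_cvg; apply: cauchy_exP => e e0.
  have [N _ uN] := cvgr_lt _ u_cvg _ e0.
  exists (x N); exists N => // n /= Nn; rewrite ballEmdist /=.
  rewrite -(subnKC Nn) (le_lt_trans (xx _ _))//.
  by rewrite (le_lt_trans _ (uN N _))//= lerBlDr lerDl.
exists a => //; apply/ler_addgt0Pr => e e0.
have [N _ xN] := cvg_ball xa e0.
have /= := xN N (leqnn N); rewrite ballEmdist /= metric_sym => aN.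
have := xx 0%N N; rewrite add0n.
by have := metric_triangle (x 0%N) (x N) a; have := u_ge0 N; lra.
Qed.

End telescoping_sequence.

(** * Residuals under a translation-invariant metric *)

Section linear_metric_theory.
Context {R : realType} {Y : topologicalLmodType R} {rho : Y -> Y -> R}.
Hypotheses (rho_metric : linear_metric rho)
  (rho_inv : translation_invariant rho).

(** Translation by [a + b - y] carries [y - a] to [b] and [y - b] to [a]; symmetry does the rest. *)
Lemma rho_subl (y a b : Y) : rho (y - a) (y - b) = rho a b.
Proof.
rewrite -(rho_inv _ _ (a + b - y)).
rewrite {1}(_ : a + b - y = b - (y - a)); last by rewrite opprB addrCA addrA.
rewrite (_ : a + b - y = a - (y - b)); last by rewrite opprB addrA.
by rewrite !(addrC (y - _)) !subrK rho_sym.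
Qed.

Lemma dist_to_add_sv (X : Type) (F : X -> set Y) (g : X -> Y) x y :
  dist_to rho (add_sv F g x) y = dist_to rho (F x) (y - g x).
Proof.
have E z : rho y (z + g x) = rho (y - g x) z.
  by rewrite -[RHS](rho_inv _ _ (g x)) subrK.
apply/eqP; rewrite eq_le; apply/andP; split; apply: le_dist_to.
  by move=> z Fz; rewrite -E; apply: dist_to_le; exists z.
by move=> _ [z Fz <-]; rewrite E; exact: dist_to_le.
Qed.

End linear_metric_theory.

Lemma inv_add_sv {X : Type} {Y : zmodType} {F : X -> set Y} {g : X -> Y} {x y} :
  F x (y - g x) -> inv_sv (add_sv F g) y x.
Proof. by move=> Fx; exists (y - g x) => //; rewrite subrK. Qed.

(** * The iteration from a fixed starting point *)

Section contracting_iteration.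
Context {R : realType} {X : completeMetricType R}.
Context {Y : topologicalLmodType R} {rho : Y -> Y -> R}.
Hypotheses (rho_metric : linear_metric rho)
  (rho_inv : translation_invariant rho).
Context {r kappa l hk : R} {U : set X} {V : set Y}.
Context {F : X -> set Y} {g : X -> Y}.
Hypotheses (r_gt0 : 0 < r) (kappa_gt0 : 0 < kappa) (l_gt0 : 0 < l)
  (hk_gt0 : 0 < hk) (hk_gt : kappa * (1 + hk * l) < hk).
Hypothesis V_neq0 : V !=set0.
Hypothesis F_reg : milyutin_regular mdist rho F (U `*` V) r kappa.
Hypothesis g_lip : lipschitz_cst_on mdist rho U l g.

(* The constant for which [k / (1 - k * l) = hk]. *)
Let k := hk / (1 + hk * l).
Let q := k * l.

Let hkl_gt0 : 0 < 1 + hk * l.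
Proof. by rewrite addr_gt0// mulr_gt0. Qed.

Let kappa_lt_k : kappa < k.
Proof. by rewrite ltr_pdivlMr. Qed.

Let q_gt0 : 0 < q.
Proof. by rewrite !mulr_gt0// invr_gt0. Qed.

Let q_lt1 : q < 1.
Proof. by rewrite /q /k mulrAC ltr_pdivrMr// mul1r ltrDr. Qed.

Let hk_1Bq : hk * (1 - q) = k.
Proof. by rewrite /q /k; field; rewrite gt_eqF. Qed.

(** [c] is a real lower bound for the distance from [x0] to the complement of [U], so an infinite
    distance needs no separate case. *)
Context {x0 : X} {y : Y} {t c : R}.
Hypotheses (t_gt0 : 0 < t) (c_far : forall a, ~ U a -> c < mdist x0 a).
Hypotheses (t_le1 : hk * t <= c) (t_le2 : hk * t <= kappa * r * c).
Hypothesis V_near : forall b, rho (y - g x0) b <= l * (hk * t) -> V b.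

(* [s] bounds the current residual; the distance travelled so far is at most
   [hk] times the decrease of that bound. *)
Let Inv (s : R) (x : X) :=
  mdist x0 x <= hk * (t - s) /\ exists2 z, F x z & rho (y - g x) z <= s.

Let Inv_U {s : R} {x} : 0 < s -> Inv s x -> U x.
Proof.
move=> s0 [xx0 _]; apply: contrapT => /c_far; apply/negP; rewrite -leNgt.
by rewrite (le_trans xx0)// (le_trans _ t_le1)// ler_pM2l// gerBl ltW.
Qed.

Let iteration_step {s : R} {x} : 0 < s -> s <= t -> Inv s x ->
  exists x', [/\ F x' (y - g x), mdist x x' <= hk * (s - q * s) &
                 Inv (q * s) x'].
Proof.
move=> s0 st Isx; have Ux := Inv_U s0 Isx; case: Isx => xx0 [z Fz zs].
have Ux0 : U x0.
  apply: contrapT => /c_far; rewrite mdistxx ltNge (le_trans _ t_le1)//.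
  by rewrite ltW// mulr_gt0.
have hst : hk * (t - s) <= hk * t by rewrite ler_pM2l// gerBl ltW.
have Vx : V (y - g x).
  apply: V_near; rewrite rho_subl// (le_trans (g_lip _ _ Ux0 Ux))// ler_pM2l//.
  exact: le_trans hst.
have dFz : (dist_to rho (F x) (y - g x)%R <= s%:E)%E.
  by rewrite (le_trans (dist_to_le Fz))// lee_fin.
have dU : ((c - hk * (t - s))%:E <= dist_to mdist (~` U) x)%E.
  apply: le_dist_to => a /c_far ca; rewrite lee_fin.
  by have := metric_triangle x0 x a; lra.
have proj : fst @` (U `*` V) = U.
  apply/seteqP; split=> [_ [[a b] [/= Ua _] <-]//|a Ua].
  by have [b Vb] := V_neq0; exists (a, b).
(* The distance to the complement of [U] shrinks along the iteration, but at
   least a fraction [s / t] of the initial margin [c] survives, and the residual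
   has shrunk by the same factor. *)
have s_lt : s < r * (c - hk * (t - s)).
  have hk_kappa : kappa < hk.
    by rewrite (le_lt_trans _ hk_gt)// ler_pMr// lerDl mulr_ge0// ltW.
  have kt0 : 0 < kappa * t by rewrite mulr_gt0.
  have h1 : c * s <= t * (c - hk * (t - s)).
    have : hk * t * (t - s) <= c * (t - s) by rewrite ler_wpM2r// subr_ge0.
    lra.
  have h2 : kappa * r * (c * s) <= kappa * r * (t * (c - hk * (t - s))).
    by rewrite ler_pM2l// mulr_gt0.
  have h3 : hk * t * s <= kappa * r * c * s by rewrite ler_pM2r.
  have h4 : kappa * (t * s) < hk * (t * s) by rewrite ltr_pM2r// mulr_gt0.
  rewrite -(ltr_pM2l kt0); lra.
have reg_cond : (dist_to rho (F x) (y - g x)%R <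
    r%:E * dist_to mdist (~` (fst @` (U `*` V))) x)%E.
  rewrite proj (le_lt_trans dFz)//.
  move: s_lt; rewrite -lte_fin => /lt_le_trans; apply.
  by rewrite EFinM lee_pmul2l// lte_fin.
have dist_le := F_reg _ _ (conj Ux Vx) reg_cond.
(* The infimum need not be attained; the slack [kappa < k] and [s > 0] make the bound strict and so
   provide an actual point. *)
have : (dist_to mdist (inv_sv F (y - g x)%R) x < (k * s)%:E)%E.
  apply: (le_lt_trans dist_le).
  apply: (@le_lt_trans _ _ (kappa * s)%:E); last by rewrite lte_fin ltr_pM2r.
  by rewrite EFinM lee_pmul2l// lte_fin.
move=> /dist_to_lt[x' Fx' xx']; exists x'.
(* The choice of [k] turns the step length into a difference that telescopes. *)
have ksE : k * s = hk * (s - q * s) by rewrite -hk_1Bq; ring.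
have xx'1 : mdist x x' <= hk * (s - q * s) by rewrite -ksE ltW.
have x0x' : mdist x0 x' <= hk * (t - q * s).
  rewrite (le_trans (metric_triangle _ x _))//.
  by move: xx0 xx'1; lra.
have Ux' : U x'.
  apply: contrapT => /c_far; apply/negP; rewrite -leNgt.
  rewrite (le_trans x0x')// (le_trans _ t_le1)// ler_pM2l// gerBl ltW//.
  exact: mulr_gt0.
split=> //; split=> //; exists (y - g x) => //.
rewrite rho_subl// (le_trans (g_lip _ _ Ux' Ux))// metric_sym.
by rewrite /q (mulrC k) -mulrA ler_pM2l// ltW.
Qed.

Lemma exists_perturbed_preimage :
  closed (graph_of F) -> continuous g ->
  (exists2 z, F x0 z & rho (y - g x0) z <= t) ->
  exists2 x, F x (y - g x) & mdist x0 x <= hk * t.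
Proof.
move=> F_closed g_cont z0.
pose s n := t * q ^+ n.
have s_gt0 n : 0 < s n by rewrite mulr_gt0// exprn_gt0.
have s_le n : s n <= t by rewrite ler_piMr ?exprn_ile1 ?ltW.
have sS n : q * s n = s n.+1 by rewrite /s exprS mulrCA.
(* Choice requires a total relation: where the invariant fails, the point itself is a dummy
   value. *)
have /choice[f fP] : forall p : nat * X, exists x', Inv (s p.1) p.2 ->
    [/\ F x' (y - g p.2), mdist p.2 x' <= hk * s p.1 - hk * s p.1.+1 &
        Inv (s p.1.+1) x'].
  move=> [n x] /=; have [Ix|nIx] := pselect (Inv (s n) x); last by exists x.
  have [x' xx'] := iteration_step (s_gt0 n) (s_le n) Ix.
  by exists x'; rewrite -mulrBr -sS.
pose x := fix x n := if n is m.+1 then f (m, x m) else x0.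
have Ix n : Inv (s n) (x n).
  elim: n => [|n /(fP (n, _))[]//].
  by rewrite /s expr0 mulr1; split; rewrite ?mdistxx ?subrr ?mulr0.
have [||n|a xa x0a] := @telescoping_cvg _ _ x (fun n => hk * s n).
- by move=> n; rewrite mulr_ge0// ltW.
- rewrite (_ : (fun _ => _) = geometric (hk * t) q).
    by apply: cvg_geometric; rewrite gtr0_norm.
  by apply/funext => n /=; rewrite /s mulrA.
- by case: (fP (n, x n) (Ix n)).
exists a; last by move: x0a; rewrite /s expr0 mulr1.
have gxa : (y - g (x n)) @[n --> \oo] --> y - g a.
  apply: (@continuous2_cvg _ _ _ _ _ _ (cst y) (g \o x) (fun a b => a - b)).
  - exact: (@sub_continuous Y (y, g a)).
  - exact: cvg_cst.
  - by apply: continuous_cvg => //; exact: g_cont.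
(* The indices differ by one: the graph contains [(x n.+1, y - g (x n))], and the shifted sequence
   has the same limit. *)
apply: (@closed_cvg _ _ \oo _ (fun n => (x n.+1, y - g (x n))) (graph_of F)
  F_closed _ (a, y - g a)).
  by apply: nearW => n; case: (fP (n, x n) (Ix n)).
by apply: cvg_pair gxa; have := xa; rewrite -cvg_shiftS.
Qed.

End contracting_iteration.

Theorem theorem3p9 (R : realType) (X : completeMetricType R)
    (Y : topologicalLmodType R) (rho : Y -> Y -> R)
    (rho_metric : linear_metric rho) (rho_inv : translation_invariant rho)
    (r eps kappa l : R)
    (r_gt0 : 0 < r) (eps_gt0 : 0 < eps) (kappa_gt0 : 0 < kappa) (l_gt0 : 0 < l)
    (kappal_lt1 : kappa * l < 1)
    (U : set X) (V : set Y)
    (U_open : open U) (U_neq0 : U !=set0)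
    (V_open : open V) (V_neq0 : V !=set0)
    (F : X -> set Y) (F_closed : closed (graph_of F))
    (g : X -> Y) (g_cont : continuous g)
    (W_neq0 : W_eps mdist rho U V g eps l !=set0)
    (F_reg : milyutin_regular mdist rho F (U `*` V) r kappa)
    (g_lip : lipschitz_cst_on mdist rho U l g) :
  forall hkappa : R, kappa / (1 - kappa * l) < hkappa ->
    milyutin_regular mdist rho (add_sv F g) (W_eps mdist rho U V g eps l)
      (Num.min (Num.min (kappa * r) eps) 1 / hkappa) hkappa.
Proof.
move=> hk hk_gt x y [Ux xyV].
set m := Num.min _ 1.
have kl_gt0 : 0 < 1 - kappa * l by rewrite subr_gt0.
have hk_gt0 : 0 < hk by rewrite (lt_trans _ hk_gt)// divr_gt0.
have hk_gt' : kappa * (1 + hk * l) < hk.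
  by move: hk_gt; rewrite ltr_pdivrMr//; lra.
have m_gt0 : 0 < m by rewrite !lt_min mulr_gt0// eps_gt0 ltr01.
have m_le1 : m <= 1 by rewrite ge_min lexx orbT.
have m_le_eps : m <= eps by rewrite !ge_min lexx orbT.
have m_le_kr : m <= kappa * r by rewrite !ge_min lexx.
rewrite (dist_to_add_sv rho_inv) => dist_lt.
(* Arguing by contradiction leaves room for a real [t] strictly above the
   residual, which is thus positive even when the residual vanishes. *)
rewrite leNgt; apply/negP => hk_dist_lt.
(* The first bound will contradict the preimage that the iteration finds; the second gives the
   margin [c]. *)
have : (dist_to rho (F x) (y - g x)%R <
    Order.min (hk^-1%:E * dist_to mdist (inv_sv (add_sv F g) y) x)
              ((m / hk)%:E * dist_to mdist (~` U) x))%E.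
  rewrite lt_min lte_pdivlMl// hk_dist_lt (lt_le_trans dist_lt)//.
  rewrite lee_pmul2l ?lte_fin ?divr_gt0//.
  by apply: dist_to_subset; apply: subsetC => _ [p [Up _] <-].
have rho0 : (0 <= dist_to rho (F x) (y - g x)%R)%E.
  by apply: le_dist_to => a _; rewrite lee_fin; exact: rho_ge0.
move=> /(lte_between_fin rho0)[t []] Ft.
rewrite lt_min lte_pdivlMl// => /andP[t_lt_inv t_lt_U].
have t_gt0 : 0 < t by rewrite -lte_fin (le_lt_trans rho0).
have [z Fz /ltW zt] := dist_to_lt Ft.
(* Chosen so that [hk * t = m * c]; the bounds of [m] by [1], [kappa * r] and [eps] then yield
   [t_le1], [t_le2] and [V_near]. *)
pose c := t / (m / hk).
have htE : hk * t = m * c.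
  by rewrite /c; field; rewrite !gt_eqF.
have c_gt0 : 0 < c by rewrite !divr_gt0.
have c_lt : (c%:E < dist_to mdist (~` U) x)%E.
  have tE : (m / hk)%R * c = t.
    by rewrite /c mulrC divfK// gt_eqF// divr_gt0.
  by rewrite -(@lte_pmul2l _ (m / hk)%:E) ?lte_fin ?divr_gt0// -EFinM tE.
have c_far a : ~ U a -> c < mdist x a.
  by move=> Ua; rewrite -lte_fin (lt_le_trans c_lt)// dist_to_le.
have V_near b : rho (y - g x) b <= l * (hk * t) -> V b.
  move=> xb; apply: xyV; rewrite /eball /=.
  apply: (@le_lt_trans _ _ ((eps * l) * c)%:E).
    rewrite lee_fin (le_trans xb)// htE (mulrC eps) -mulrA ler_pM2l//.
    by rewrite ler_pM2r.
  by rewrite EFinM lte_pmul2l// lte_fin mulr_gt0.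
have [|||x' Fx' xx'] := exists_perturbed_preimage rho_metric rho_inv r_gt0
  kappa_gt0 l_gt0 hk_gt0 hk_gt' V_neq0 F_reg g_lip t_gt0 c_far _ _ V_near
  F_closed g_cont.
- by rewrite htE ler_piMl// ltW.
- by rewrite htE ler_pM2r.
- by exists z.
move: t_lt_inv; apply/negP; rewrite -leNgt.
by rewrite (le_trans (dist_to_le (inv_add_sv Fx')))// lee_fin.
Qed.
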